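(* Let $\rho$ be an invertible $2\times2$ density matrix and write $x=\operatorname{OMC}(\rho)\in[0,1)$. Then $$S(\rho)=\ln2-\tfrac12\big[(1+x)\ln(1+x)+(1-x)\ln(1-x)\big].$$ Equivalently, in terms of $\eta=\operatorname{OLC}(\rho)=\operatorname{arctanh}(x)$, $$S(\rho)=\ln2-\tfrac12\big[(1+\tanh\eta)\ln(1+\tanh\eta)+(1-\tanh\eta)\ln(1-\tanh\eta)\big].$$ The map $x\mapsto S$ given by the first formula is a strictly decreasing bijection $[0,1)\to(0,\ln2]$, with $S=\ln2$ at $x=0$ (the maximally mixed state) and $S\to0$ as $x\to1$.
   Context: A density matrix is a positive semidefinite complex matrix of trace $1$. $S(\rho)=-\sum_i\lambda_i\ln\lambda_i$ is the von Neumann entropy, where $\lambda_i$ are the eigenvalues of $\rho$. For an invertible matrix $A$: $\kappa(A):=\|A\|\,\|A^{-1}\|$ (operator norm), $\operatorname{OMC}(A):=(\kappa(A)-1)/(\kappa(A)+1)$, $\operatorname{OLC}(A):=\operatorname{arctanh}(\operatorname{OMC}(A))=\tfrac12\ln\kappa(A)$. *)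

(* Defs.v *)
From HB Require Import structures.
From mathcomp Require Import all_boot all_order all_algebra.
From mathcomp Require Import spectral complex.
From mathcomp Require Import all_classical all_reals all_analysis.
From mathcomp Require Import ring lra.

Set Implicit Arguments.
Unset Strict Implicit.
Unset Printing Implicit Defensive.
Import Order.TTheory GRing.Theory Num.Theory.
Import numFieldNormedType.Exports.

Local Open Scope classical_set_scope.
Local Open Scope complex_scope.
Local Open Scope sesquilinear_scope.
Local Open Scope ring_scope.

Section Matrices.
Variable R : realType.
Implicit Types m n : nat.

(* In the order of R[i], 0 <= z means that z is real and nonnegative. *)
Definition psd_mx n (A : 'M[R[i]]_n) : Prop :=
  A \is hermsymmx /\ forall v : 'cV[R[i]]_n, 0 <= (v ^t* *m A *m v) 0 0.

Definition density_mx n (A : 'M[R[i]]_n) : Prop := psd_mx A /\ \tr A = 1.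

Definition l2norm n (v : 'cV[R[i]]_n) : R :=
  Num.sqrt (\sum_(i < n) complex.Re `|v i 0| ^+ 2).

Definition opnorm m n (A : 'M[R[i]]_(m, n)) : R :=
  sup [set l2norm (A *m v) | v in [set v | l2norm v <= 1]].

(* The roots of the characteristic polynomial, listed with multiplicity. *)
Definition eigenvalues n (A : 'M[R[i]]_n) : seq R[i] :=
  sval (closed_field_poly_normal (char_poly A)).

(* Real parts lose nothing for Hermitian A. As ln 0 = 0, a zero eigenvalue
   contributes 0. *)
Definition entropy n (A : 'M[R[i]]_n) : R :=
  - \sum_(l <- eigenvalues A) complex.Re l * ln (complex.Re l).

Definition kappa n (A : 'M[R[i]]_n) : R := opnorm A * opnorm (invmx A).

Definition OMC n (A : 'M[R[i]]_n) : R := (kappa A - 1) / (kappa A + 1).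

Definition tanh (x : R) : R :=
  (expR x - expR (- x)) / (expR x + expR (- x)).

Definition artanh (x : R) : R := 2^-1 * ln ((1 + x) / (1 - x)).

Definition OLC n (A : 'M[R[i]]_n) : R := artanh (OMC A).

Definition qubit_entropy (x : R) : R :=
  ln 2 - 2^-1 * ((1 + x) * ln (1 + x) + (1 - x) * ln (1 - x)).

Definition maximally_mixed n : 'M[R[i]]_n := (n%:R^-1)%:M.

Lemma eigenvaluesP n (A : 'M[R[i]]_n) :
  char_poly A = \prod_(l <- eigenvalues A) ('X - l%:P).
Proof.
rewrite /eigenvalues; case: closed_field_poly_normal => s /= {1}->.
by rewrite (monicP (char_poly_monic A)) scale1r.
Qed.

Lemma artanhK (x : R) : -1 < x -> x < 1 -> tanh (artanh x) = x.
Proof.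
move=> x1 x2.
have a0 : 0 < 1 + x by rewrite -ltrBlDl sub0r.
have b0 : 0 < 1 - x by rewrite subr_gt0.
have q0 : 0 < (1 + x) / (1 - x) by rewrite divr_gt0.
set e := expR (artanh x).
have e0 : 0 < e by exact: expR_gt0.
have e2 : e ^+ 2 = (1 + x) / (1 - x).
  by rewrite -expRM_natl mulrA divff ?pnatr_eq0// mul1r lnK.
have d0 : e ^+ 2 + 1 != 0 by rewrite gt_eqF// ltr_wpDr// exprn_gt0.
have ne : e != 0 by rewrite gt_eqF.
have nb : 1 - x != 0 by rewrite gt_eqF.
have -> : tanh (artanh x) = (e ^+ 2 - 1) / (e ^+ 2 + 1).
  rewrite /tanh expRN -/e; field.
  by rewrite ne d0.
by rewrite e2; field; rewrite nb; apply/eqP; lra.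
Qed.

Lemma OLC_kappa n (A : 'M[R[i]]_n) :
  0 < kappa A -> OLC A = 2^-1 * ln (kappa A).
Proof.
move=> k0; rewrite /OLC /artanh /OMC; congr (_ * ln _).
have d0 : kappa A + 1 != 0 by rewrite gt_eqF// addr_gt0.
by field; rewrite d0; apply/eqP; lra.
Qed.

End Matrices.

(* Main.v *)
(* Diagonalise rho in an orthonormal basis, with eigenvalues r0, r1 > 0 and
   r0 + r1 = 1. The operator norm of a unitarily diagonalised matrix is its
   largest eigenvalue modulus, so kappa rho = max r / min r and
   OMC rho = |r0 - r1|. As 1 + (r0 - r1) = 2 r0 and 1 - (r0 - r1) = 2 r1, the
   entropy is qubit_entropy (r0 - r1), and qubit_entropy is even.
   Since y ln y extends continuously by 0 at y = 0, qubit_entropy is continuous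
   on the closed interval [0, 1] and vanishes at 1; its derivative
   (ln (1 - x) - ln (1 + x)) / 2 is negative on ]0, 1[, and the intermediate
   value theorem gives the bijection. *)
Require Import Defs.
From HB Require Import structures.
From mathcomp Require Import all_boot all_order all_algebra.
From mathcomp Require Import spectral complex.
From mathcomp Require Import all_classical all_reals all_analysis.
From mathcomp Require Import ring lra.

Set Implicit Arguments.
Unset Strict Implicit.
Unset Printing Implicit Defensive.
Import Order.TTheory GRing.Theory Num.Theory.
Import numFieldNormedType.Exports.

Local Open Scope classical_set_scope.
Local Open Scope complex_scope.
Local Open Scope ring_scope.

Lemma ord2P (i j k : 'I_2) : j != k -> pred2 j k i.
Proof.
rewrite /= -!(inj_eq val_inj).
by case: i j k => [[|[|]]// ?] [[|[|]]// ?] [[|[|]]// ?].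
Qed.

Section QubitEntropy.
Variable R : realType.
Local Open Scope sesquilinear_scope.
Implicit Types x y : R.
Local Notation C := R[i].

(** * Euclidean norm and operator norm under unitary conjugation *)

(** The norm on [R[i]] is itself valued in [R[i]]; this allows passing to its real part and back. *)
Lemma Re_norm (z : C) : (complex.Re `|z|)%:C = `|z|.
Proof. exact/RRe_real/normr_real. Qed.

Lemma Re_norm_ge0 (z : C) : 0 <= complex.Re `|z|.
Proof. by rewrite -ler0c Re_norm. Qed.

Lemma Re_normM (z w : C) :
  complex.Re `|z * w| = complex.Re `|z| * complex.Re `|w|.
Proof. exact: Normc.normcM. Qed.

Lemma l2norm_ge0 n (v : 'cV[C]_n) : 0 <= l2norm v.
Proof. exact: sqrtr_ge0. Qed.

Lemma sqr_l2norm n (v : 'cV[C]_n) :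
  l2norm v ^+ 2 = \sum_(i < n) complex.Re `|v i 0| ^+ 2.
Proof. by rewrite sqr_sqrtr// sumr_ge0// => i _; rewrite sqr_ge0. Qed.

(** As a Hermitian form, the squared norm turns unitary invariance into cancelling [P] against its
    adjoint. *)
Lemma sqr_l2normE n (v : 'cV[C]_n) : (l2norm v ^+ 2)%:C = (v ^t* *m v) 0 0.
Proof.
rewrite sqr_l2norm mxE rmorph_sum; apply: eq_bigr => i _.
by rewrite !mxE -normCKC rmorphXn; congr (_ ^+ 2); exact: Re_norm.
Qed.

Lemma l2norm_unitary n (P : 'M[C]_n) (v : 'cV[C]_n) :
  P \is unitarymx -> l2norm (P *m v) = l2norm v.
Proof.
move=> Pu; apply/eqP; rewrite -(@eqrXn2 _ 2)// ?l2norm_ge0//.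
apply/eqP/complexI; rewrite !sqr_l2normE trmx_mul map_mxM mulmxA.
by rewrite mulmxKtV// -trmxC_unitary//.
Qed.

Lemma l2norm_delta n (k : 'I_n) : l2norm (delta_mx k 0 : 'cV[C]_n) = 1.
Proof.
apply/eqP; rewrite -(@eqrXn2 _ 2)// ?l2norm_ge0//; apply/eqP.
rewrite sqr_l2norm (bigD1 k)// big1 => [|i ik]; rewrite mxE ?eqxx ?andbT.
  by rewrite mulr1n normr1 /= expr1n addr0.
by rewrite (negbTE ik) normr0 expr0n.
Qed.

Lemma opnorm_unitary_diag n (P : 'M[C]_n) (d : 'rV[C]_n) (k : 'I_n) :
  P \is unitarymx -> (forall i, `|d 0 i| <= `|d 0 k|) ->
  opnorm (invmx P *m diag_mx d *m P) = complex.Re `|d 0 k|.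
Proof.
move=> Pu dk; have Pi := unitarymx_unit Pu.
have Pu' : invmx P \is unitarymx by rewrite invmx_unitary// trmxC_unitary.
rewrite /opnorm; set S := (X in sup X).
have ubS : ubound S (complex.Re `|d 0 k|).
  move=> _ [v /= v1 <-]; rewrite -!mulmxA l2norm_unitary//.
  (* Since [P] is an isometry, [w = P *m v] lies in the unit ball too, and only the diagonal factor
     remains. *)
  rewrite -(l2norm_unitary v Pu) in v1; move: (P *m v) v1 => w w1.
  have m0 : 0 <= complex.Re `|d 0 k| := Re_norm_ge0 _.
  rewrite -(@ler_pXn2r _ 2) ?nnegrE ?l2norm_ge0//.
  apply: (@le_trans _ _ (complex.Re `|d 0 k| ^+ 2 * l2norm w ^+ 2)); last first.
    by rewrite ler_piMr ?sqr_ge0// expr_le1// l2norm_ge0.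
  rewrite !sqr_l2norm mulr_sumr; apply: ler_sum => i _.
  rewrite mul_diag_mx mxE Re_normM -exprMn ler_pXn2r ?nnegrE ?mulr_ge0 ?Re_norm_ge0//.
  by rewrite ler_wpM2r ?Re_norm_ge0// -lecR !Re_norm.
have Sk : S (complex.Re `|d 0 k|).
  (* The bound is attained at a unit eigenvector for [d 0 k]. *)
  exists (invmx P *m delta_mx k 0) => /=; first by rewrite l2norm_unitary// l2norm_delta.
  rewrite mulmxA mulmxK// -mulmxA l2norm_unitary//.
  have -> : diag_mx d *m delta_mx k 0 = d 0 k *: (delta_mx k 0 : 'cV[C]_n).
    apply/matrixP => i j; rewrite mul_diag_mx !mxE.
    by have [->//|] := eqVneq i k; rewrite !mulr0.
  have n0 : 0 <= complex.Re `|d 0 k| := Re_norm_ge0 _.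
  apply/eqP; rewrite -(@eqrXn2 _ 2)// ?l2norm_ge0//; apply/eqP.
  rewrite sqr_l2norm (bigD1 k)// big1 => [|i ik]; rewrite !mxE ?eqxx ?andbT.
    by rewrite mulr1n mulr1 /= addr0.
  by rewrite (negbTE ik) mulr0 normr0 expr0n.
apply/le_anti/andP; split.
  by apply: ge_sup => //; exists (complex.Re `|d 0 k|).
by apply: ub_le_sup => //; exists (complex.Re `|d 0 k|).
Qed.

(** * Eigenvalues and the spectral form of a density matrix *)

Lemma char_poly_conj (F : fieldType) n (P A : 'M[F]_n) : P \in unitmx ->
  char_poly (invmx P *m A *m P) = char_poly A.
Proof.
move=> Pu; rewrite /char_poly.
have -> : char_poly_mx (invmx P *m A *m P) =
    map_mx polyC (invmx P) *m char_poly_mx A *m map_mx polyC P.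
  rewrite /char_poly_mx mulmxBr mulmxBl !map_mxM/=; congr (_ - _).
  by rewrite scalar_mxC -mulmxA -map_mxM mulVmx// map_mx1 mulmx1.
rewrite !det_mulmx mulrAC -det_mulmx -map_mxM mulVmx// map_mx1 det1.
by rewrite mul1r.
Qed.

(** The order of [eigenvalues] is unspecified, so unique factorisation of the characteristic
    polynomial gives equality only up to permutation, which suffices for the entropy sum. *)
Lemma perm_eigenvalues_diag n (P : 'M[C]_n) (d : 'rV[C]_n) : P \in unitmx ->
  perm_eq (eigenvalues (invmx P *m diag_mx d *m P)) [seq d 0 i | i : 'I_n].
Proof.
move=> Pu.
apply: prod_XsubC_eq.
rewrite -eigenvaluesP char_poly_conj// char_poly_trig ?diag_mx_is_trig//.
rewrite big_image/=; apply: eq_bigr => i _.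
by rewrite mxE eqxx.
Qed.

Lemma density_spectral (rho : 'M[C]_2) :
  density_mx rho -> rho \in unitmx ->
  exists (P : 'M[C]_2) (r : 'I_2 -> R),
  [/\ P \is unitarymx, forall i, 0 < r i, r 0 + r 1 = 1 &
    rho = invmx P *m diag_mx (\row_i (r i)%:C) *m P].
Proof.
move=> [[rho_herm rho_psd] tr1] rhoU.
have [P [d [Pu rhoE]]] : exists P (d : 'rV[C]_2),
    P \is unitarymx /\ rho = invmx P *m diag_mx d *m P.
  exists (spectralmx rho), (spectral_diag rho); split.
    exact: spectral_unitarymx.
  exact/orthomx_spectralP/hermitian_normalmx.
have Pi := unitarymx_unit Pu.
have d_ge0 i : 0 <= d 0 i.
  (* Testing positivity on the [i]-th eigenvector isolates [d 0 i]. *)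
  have := rho_psd (invmx P *m delta_mx i 0).
  rewrite {1}rhoE trmx_mul map_mxM invmx_unitary// trmxCK.
  rewrite !mulmxA !mulmxtVK//.
  rewrite trmx_delta map_delta_mx -rowE row_diag_mx -scalemxAl mxE.
  by rewrite mul_delta_mx mxE !eqxx mulr1.
have d_neq0 i : d 0 i != 0.
  move: rhoU; rewrite rhoE unitmx_mul Pi andbT unitmx_mul unitmx_inv Pi/=.
  by rewrite unitmxE det_diag unitfE => /prodf_neq0 /(_ i isT).
have dE i : (complex.Re (d 0 i))%:C = d 0 i by exact/RRe_real/ger0_real.
exists P, (fun i => complex.Re (d 0 i)); split.
- exact: Pu.
- by move=> i; rewrite -ltcR dE lt_def d_neq0 d_ge0.
- apply: complexI; rewrite rmorphD [X in X + _]dE [X in _ + X]dE.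
  apply: etrans tr1; rewrite rhoE mxtrace_mulC mulmxA mulmxV// mul1mx mxtrace_diag.
  by rewrite big_ord_recl big_ord1; congr (_ + d 0 _); apply/val_inj.
- rewrite {1}rhoE; congr (_ *m diag_mx _ *m _); apply/rowP => i.
  by rewrite mxE dE.
Qed.

Lemma mulmx1_invmx (F : comUnitRingType) n (A B : 'M[F]_n) :
  A *m B = 1%:M -> invmx A = B.
Proof.
by move=> AB; have [Au _] := mulmx1_unit AB; rewrite -[B](mulKmx Au) AB mulmx1.
Qed.

Lemma invmx_conj_diag (F : fieldType) n (P : 'M[F]_n) (d : 'rV[F]_n) :
  P \in unitmx -> (forall i, d 0 i != 0) ->
  invmx (invmx P *m diag_mx d *m P) =
  invmx P *m diag_mx (\row_i (d 0 i)^-1) *m P.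
Proof.
move=> Pu d0; apply: mulmx1_invmx.
rewrite !mulmxA mulmxK// -(mulmxA (invmx P)) mulmx_diag.
suff -> : \row_i (d 0 i * (\row_j (d 0 j)^-1) 0 i) = const_mx 1.
  by rewrite diag_const_mx mulmx1 mulVmx.
by apply/rowP => i; rewrite !mxE mulfV.
Qed.

Lemma opnorm_unitary_realdiag n (P : 'M[C]_n) (r : 'I_n -> R) k :
  P \is unitarymx -> (forall i, 0 <= r i <= r k) ->
  opnorm (invmx P *m diag_mx (\row_i (r i)%:C) *m P) = r k.
Proof.
move=> Pu rk; have normr i : `|(r i)%:C| = (r i)%:C :> C.
  by apply: ger0_norm; rewrite ler0c; have /andP[] := rk i.
rewrite (opnorm_unitary_diag (k := k))// => [|i]; rewrite !mxE !normr//.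
by rewrite lecR; have /andP[] := rk i.
Qed.

(** The dimension is a successor because the empty matrix has trace 0. *)
Lemma density_maximally_mixed n : density_mx (maximally_mixed R n.+1).
Proof.
have c_ge0 : 0 <= n.+1%:R^-1 :> C by rewrite invr_ge0 ler0n.
split; last by rewrite mxtrace_scalar -[_ *+ _]mulr_natr mulVf ?pnatr_eq0.
split.
  apply/is_hermitianmxP; rewrite expr0 scale1r tr_scalar_mx map_scalar_mx/=.
  by congr (_%:M); apply/esym/CrealP/ger0_real.
move=> v; rewrite mul_mx_scalar -scalemxAl mxE -sqr_l2normE mulr_ge0//.
by rewrite ler0c sqr_ge0.
Qed.

Lemma maximally_mixed_unit n : maximally_mixed R n.+1 \in unitmx.
Proof.
by rewrite unitmxE det_scalar unitfE expf_neq0// invr_eq0 pnatr_eq0.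
Qed.

(** * Condition number and entropy in dimension two *)

Section density2.
Variables (P : 'M[C]_2) (r : 'I_2 -> R).
Hypotheses (Pu : P \is unitarymx) (r_gt0 : forall i, 0 < r i).
Hypothesis r1 : r 0 + r 1 = 1.
Let rho := invmx P *m diag_mx (\row_i (r i)%:C) *m P.

(** Inversion turns the eigenvalues into their reciprocals, so the smaller one, [r j], gives the
    norm of the inverse. Leaving [k] and [j] abstract covers both orderings. *)
Lemma kappa_unitary_diag2 (k j : 'I_2) : k != j -> r j <= r k ->
  kappa rho = r k / r j.
Proof.
move=> kj rjk.
rewrite /kappa invmx_conj_diag ?unitarymx_unit// => [|i]; last first.
  by rewrite mxE lt0r_neq0// ltcR.
have -> : \row_i ((\row_j (r j)%:C) 0 i)^-1 = \row_i ((r i)^-1)%:C :> 'rV[C]_2.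
  by apply/rowP => i; rewrite !mxE fmorphV.
rewrite (opnorm_unitary_realdiag (k := k))// => [|i]; last first.
  by rewrite ltW//=; case/pred2P: (ord2P i kj) => ->.
rewrite (opnorm_unitary_realdiag (r := fun i => (r i)^-1) (k := j))// => i.
by rewrite invr_ge0 ltW//= lef_pV2 ?posrE//; case/pred2P: (ord2P i kj) => ->.
Qed.

(** For eigenvalues [a >= b], [(a / b - 1) / (a / b + 1) = (a - b) / (a + b)], and the trace makes
    the denominator 1. *)
Lemma OMC_unitary_diag2 : OMC rho = `|r 0 - r 1|.
Proof.
have [r01|r10] := leP (r 0) (r 1).
  rewrite /OMC (@kappa_unitary_diag2 1 0)//.
  rewrite ler0_norm ?subr_le0//; have r00 := r_gt0 0.
  have -> : r 1 = 1 - r 0 by rewrite -r1 addrC addKr.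
  by field; rewrite subrK oner_eq0 gt_eqF.
rewrite /OMC (@kappa_unitary_diag2 0 1) ?ltW//.
rewrite gtr0_norm ?subr_gt0//; have r00 := r_gt0 1.
have -> : r 0 = 1 - r 1 by rewrite -r1 addrK.
by field; rewrite subrK oner_eq0 gt_eqF.
Qed.

Lemma entropy_unitary_diag2 : entropy rho = qubit_entropy (r 0 - r 1).
Proof.
rewrite /entropy (perm_big _ (perm_eigenvalues_diag _ (unitarymx_unit Pu))).
rewrite big_image/= big_ord_recl big_ord1 !mxE/=.
have -> : lift ord0 ord0 = 1 :> 'I_2 by apply/val_inj.
rewrite /qubit_entropy.
have -> : 1 + (r 0 - r 1) = 2 * r 0 by rewrite -[X in X + _]r1; ring.
have -> : 1 - (r 0 - r 1) = 2 * r 1 by rewrite -[X in X + _]r1; ring.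
(* The terms [ln 2] split off here carry weights [r 0] and [r 1], which sum to 1, so they cancel the
   leading [ln 2]. *)
rewrite !lnM ?posrE//.
have -> : r 1 = 1 - r 0 by rewrite -r1 addrC addKr.
by field.
Qed.

End density2.

(** * Analysis of the entropy function *)

(* As ln vanishes on nonpositive reals, this holds on the whole line; near 0 it
   follows from ln u < u at u = y^(-1/2). *)
Lemma continuous_xlnx : continuous (fun x : R => x * ln x).
Proof.
move=> x; have [x0|x0|->] := ltgtP x 0.
- rewrite /continuous_at ln0 ?ltW// mulr0.
  apply/cvgrPdist_lt => e e0; near=> y.
  by rewrite ln0 ?mulr0 ?subrr ?normr0 //; apply: ltW; near: y; exact: lt_nbhsl.
- by apply: cvgM; [exact: cvg_id|exact: continuous_ln].
(* The factor 2 comes from [ln y = 2 * ln (Num.sqrt y)]; [y <= 1] fixes the sign of [ln y]. *)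
have bound y : y <= 1 -> `|y * ln y| <= 2 * Num.sqrt `|y|.
  move=> y1; have [y0|y0] := leP y 0.
    by rewrite ln0// mulr0 normr0 mulr_ge0 ?sqrtr_ge0.
  have s0 : 0 < Num.sqrt y by rewrite sqrtr_gt0.
  have yE : y = Num.sqrt y ^+ 2 by rewrite sqr_sqrtr// ltW.
  have := @ln_sublinear _ (Num.sqrt y)^-1 _; rewrite invr_gt0 => /(_ s0).
  rewrite lnV ?posrE// => lns.
  have lny : ln y = ln (Num.sqrt y) *+ 2 by rewrite [in LHS]yE lnXn.
  rewrite normrM (gtr0_norm y0) ler0_norm; last exact: ln_le0.
  rewrite lny {1}yE.
  have -> : 2 * Num.sqrt y = Num.sqrt y ^+ 2 * ((Num.sqrt y)^-1 *+ 2).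
    by rewrite expr2 mulr2n; field; rewrite gt_eqF.
  by rewrite ler_pM2l ?exprn_gt0// -mulNrn ler_pMn2r// ltW.
rewrite /continuous_at mul0r.
suff lim0 : `|y * ln y| @[y --> (0 : R)] --> (0 : R) by exact: norm_cvg0.
apply: (squeeze_cvgr (f := fun=> 0) (h := fun y : R => 2 * Num.sqrt `|y|)).
- near=> y; rewrite normr_ge0/=; apply: bound.
  by apply: ltW; near: y; apply: lt_nbhsl; exact: ltr01.
- exact: cvg_cst.
rewrite -[X in _ --> X](mulr0 2) -[X in _ * X](sqrtr0 R) -[X in Num.sqrt X](normr0 R).
apply: cvgMr; apply: (@continuous_comp _ _ _ (@Num.norm _ R) Num.sqrt 0).
  exact: norm_continuous.
exact: sqrt_continuous.
Unshelve. all: by end_near. Qed.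

Lemma continuous_qubit_entropy : continuous (@qubit_entropy R).
Proof.
move=> x; apply: cvgB; first exact: cvg_cst.
apply: cvgMr; apply: cvgD.
  apply: (@continuous_comp _ _ _ (fun y => 1 + y) (fun y => y * ln y)).
    by apply: cvgD; [exact: cvg_cst|exact: cvg_id].
  exact: continuous_xlnx.
apply: (@continuous_comp _ _ _ (fun y => 1 - y) (fun y => y * ln y)).
  by apply: cvgB; [exact: cvg_cst|exact: cvg_id].
exact: continuous_xlnx.
Qed.

(** The product rule gives [ln (1 + x) + 1] and [- ln (1 - x) - 1], whose constants cancel. *)
Lemma is_derive_qubit_entropy x : -1 < x -> x < 1 ->
  is_derive x 1 (@qubit_entropy R) (2^-1 * (ln (1 - x) - ln (1 + x))).
Proof.
move=> x1 x2.
have a0 : 0 < 1 + x by lra.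
have b0 : 0 < 1 - x by lra.
have lnD : is_derive x (1:R) (fun y => ln (1 + y)) (1 + x)^-1.
  apply: (@is_derive_eq _ _ _ _ _ _ _ _ (is_derive1_comp (is_derive1_ln a0) _)).
  by rewrite add0r mulr1.
have lnB : is_derive x (1:R) (fun y => ln (1 - y)) (- (1 - x)^-1).
  have dB : is_derive x (1:R) (fun y => 1 - y) (-1).
    by apply: is_derive_eq; rewrite add0r mul1r.
  have := @is_derive1_comp _ _ (fun y => 1 - y) _ _ _ (is_derive1_ln b0) dB.
  move=> dlnB; apply: (@is_derive_eq _ _ _ _ _ _ _ _ dlnB).
  by rewrite mulrN1.
rewrite /qubit_entropy; apply: is_derive_eq.
rewrite /GRing.scale/=; field.
by rewrite !gt_eqF.
Qed.

Lemma qubit_entropyN x : qubit_entropy (- x) = qubit_entropy x.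
Proof. by rewrite /qubit_entropy opprK [X in _ - _ * X]addrC. Qed.

Lemma qubit_entropy0 : qubit_entropy 0 = ln 2 :> R.
Proof. by rewrite /qubit_entropy subr0 addr0 ln1 mulr0 addr0 mulr0 subr0. Qed.

Lemma qubit_entropy1 : qubit_entropy 1 = 0 :> R.
Proof.
rewrite /qubit_entropy subrr mul0r addr0 mulrA mulVf ?pnatr_eq0// mul1r.
by rewrite subrr.
Qed.

(** The endpoint 1 is included so that comparison with the value 0 there yields positivity on [[0,
    1[]. *)
Lemma qubit_entropy_decr :
  {in `[0, 1] &, {homo @qubit_entropy R : x y /~ x < y}}.
Proof.
move=> x y; rewrite !in_itv/= => /andP[x0 x1] /andP[y0 y1] yx.
have dq (z : R) : z \in `]0, 1[%R ->
    is_derive z 1 (@qubit_entropy R) (2^-1 * (ln (1 - z) - ln (1 + z))).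
  by rewrite in_itv/= => /andP[z0 z1]; apply: is_derive_qubit_entropy => //; lra.
apply: (@ltr0_derive1_decr _ (@qubit_entropy R) 0 1).
- by move=> z /dq [].
- move=> z z01; have := z01; rewrite in_itv/= => /andP[z0 z1].
  rewrite derive1E; have [_ ->] := dq _ z01.
  by rewrite pmulr_rlt0 ?invr_gt0// subr_lt0 ltr_ln ?posrE; lra.
- exact/continuous_subspaceT/continuous_qubit_entropy.
- exact: y0.
- exact: yx.
- exact: x1.
Qed.

Lemma qubit_entropy_bij : set_bij `[0, 1[ `]0, ln 2] (@qubit_entropy R).
Proof.
split.
- move=> x; rewrite /= !in_itv/= => /andP[x0 x1]; apply/andP; split.
    by rewrite -qubit_entropy1; apply: qubit_entropy_decr => //;
      rewrite in_itv/= ?x0 ?ler01 ?lexx ?ltW.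
  rewrite -qubit_entropy0; have [->//|xn0] := eqVneq x 0.
  by apply/ltW/qubit_entropy_decr; rewrite ?in_itv/= ?x0 ?ler01 ?lexx ?(ltW x1)//
    lt_neqAle eq_sym xn0.
- move=> x y; rewrite !inE/= !in_itv/= => /andP[x0 x1] /andP[y0 y1] fxy.
  have [xy|yx|//] := ltgtP x y.
    have := qubit_entropy_decr _ _ xy.
    by rewrite fxy ltxx !in_itv/= x0 y0 !ltW// => /(_ isT isT).
  have := qubit_entropy_decr _ _ yx.
  by rewrite fxy ltxx !in_itv/= x0 y0 !ltW// => /(_ isT isT).
- move=> y; rewrite /= in_itv/= => /andP[y0 y2].
  have l0 : 0 <= ln 2 :> R := ltW (lt_le_trans y0 y2).
  have := @IVT _ (@qubit_entropy R) 0 1 y ler01.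
  rewrite qubit_entropy0 qubit_entropy1 (min_r l0) (max_l l0) (ltW y0) y2.
  case=> //; first exact/continuous_subspaceT/continuous_qubit_entropy.
  move=> x; rewrite in_itv/= => /andP[x0 x1] xy; exists x => //=.
  (* The intermediate value theorem allows [x = 1], which is excluded because the value there is 0
     while [y > 0]. *)
  rewrite in_itv/= x0 lt_neqAle x1 andbT; apply/eqP => x1E.
  by move: y0; rewrite -xy x1E qubit_entropy1 ltxx.
Qed.

End QubitEntropy.

Theorem proposition5p4 (R : realType) :
  (forall rho : 'M[R[i]]_2, density_mx rho -> rho \in unitmx ->
     [/\ 0 <= OMC rho < 1,
         entropy rho = qubit_entropy (OMC rho) &
         entropy rho = qubit_entropy (tanh (OLC rho))]) /\
  [/\ {in `[0, 1[ &, {homo @qubit_entropy R : x y /~ x < y}},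
      set_bij `[0, 1[ `]0, ln 2] (@qubit_entropy R),
      qubit_entropy 0 = ln 2 :> R,
      [/\ density_mx (maximally_mixed R 2), maximally_mixed R 2 \in unitmx &
          forall rho : 'M[R[i]]_2, density_mx rho -> rho \in unitmx ->
            OMC rho = 0 <-> rho = maximally_mixed R 2] &
      qubit_entropy x @[x --> (1 : R)^'-] --> (0 : R)].
Proof.
(* One diagonalisation serves all the claims about a given state. *)
have spec rho : density_mx rho -> rho \in unitmx ->
    [/\ 0 <= OMC rho < 1, entropy rho = qubit_entropy (OMC rho) &
        OMC rho = 0 <-> rho = maximally_mixed R 2].
  move=> /density_spectral/[apply] -[P [r [Pu r_gt0 r1 rhoE]]].
  have r00 := r_gt0 0; have r10 := r_gt0 1.
  have OMCE : OMC rho = `|r 0 - r 1| by rewrite rhoE OMC_unitary_diag2.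
  split.
  - by rewrite OMCE normr_ge0 ltr_norml -r1; apply/andP; split; lra.
  - rewrite OMCE {1}rhoE entropy_unitary_diag2//.
    (* Evenness absorbs the absolute value when [r 0 < r 1]. *)
    by have [_|_] := ger0P (r 0 - r 1); rewrite ?qubit_entropyN.
  - rewrite OMCE; split.
      (* Equal eigenvalues with sum 1 are both 1/2, and conjugation fixes a scalar matrix. *)
      move=> /normr0_eq0/subr0_eq r01.
      rewrite rhoE; have -> : \row_i (r i)%:C = const_mx 2%:R^-1 :> 'rV[R[i]]_2.
        apply/rowP => i; rewrite !mxE.
        have -> : r i = 2%:R^-1.
          have /pred2P[->|->] := @ord2P i 0 1 isT; lra.
        by rewrite fmorphV rmorph_nat.
      by rewrite diag_const_mx scalar_mxC -mulmxA mulVmx ?mulmx1// unitarymx_unit.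
    (* Conversely, undoing the conjugation of a scalar matrix returns the same scalar matrix, so the
       two diagonal entries agree. *)
    move=> rhoM; have Pi := unitarymx_unit Pu.
    have : P *m rho *m invmx P = diag_mx (\row_i (r i)%:C).
      by rewrite rhoE !mulmxA mulmxV// mul1mx mulmxK.
    rewrite rhoM scalar_mxC mulmxK// => /matrixP diagE.
    have := diagE 0 0; have := diagE 1 1; rewrite !mxE !mulr1n => -> /complexI ->.
    by rewrite subrr normr0.
split.
  move=> rho rho_density rhoU.
  have [/andP[x0 x1] SE _] := spec _ rho_density rhoU.
  by split; rewrite ?x0// /OLC artanhK// (lt_le_trans _ x0)// ltrN10.
split.
- move=> x y; rewrite !in_itv/= => /andP[x0 x1] /andP[y0 y1].
  by apply: qubit_entropy_decr; rewrite in_itv/= ?x0 ?y0 ltW.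
- exact: qubit_entropy_bij.
- exact: qubit_entropy0.
- split => [||rho rho_density rhoU]; last by have [] := spec _ rho_density rhoU.
    exact: density_maximally_mixed.
  exact: maximally_mixed_unit.
(* Continuity at 1 itself reduces the one-sided limit to a value. *)
- rewrite -[X in _ --> X]qubit_entropy1.
  exact/cvg_at_left_filter/continuous_qubit_entropy.
Qed.
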